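(* Let $b \geq 3$ be a fixed integer, let $\mathcal{Z}_b(x)$ be the set of base-$b$ Zuckerman numbers not exceeding $x$, and let $z_b^+$ be the constant defined in the context. Then $$|\mathcal{Z}_b(x)| < x^{z_b^+ + o(1)}$$ as $x \to +\infty$, where the rate at which $o(1)$ tends to zero may depend on $b$.
   Context: A positive integer $n$ is a base-$b$ Zuckerman number if $n$ is divisible by the product of its base-$b$ digits (a number having a digit $0$ is not a Zuckerman number, since its digit product is $0$). Let $\Omega_b$ be the family of all subsets $\mathcal{D} \subseteq \{1,\dots,b-1\}$ such that $b$ does not divide $d_1 \cdots d_k$ for all $k \geq 1$ and all (not necessarily distinct) $d_1,\dots,d_k \in \mathcal{D}$. Let $\Omega_b^*$ be the family of all $\mathcal{D} \in \Omega_b$ that are maximal with respect to inclusion, i.e. such that there is no $\mathcal{D}' \in \Omega_b$ with $\mathcal{D} \subsetneq \mathcal{D}'$. For real $s \geq 0$ and $\mathcal{D} \in \Omega_b^*$ put $\zeta_{\mathcal{D}}(s) := \sum_{d \in \mathcal{D}} d^{-s}$, and let $\zeta_{\mathcal{D}}'$ be its derivative in $s$. For every $\mathcal{D} \in \Omega_b^*$ the equation $$\left(s + \frac{\log|\mathcal{D}|}{\log b}\right) \frac{\zeta_{\mathcal{D}}'(s)}{\zeta_{\mathcal{D}}(s)} - \log\left(\frac{\zeta_{\mathcal{D}}(s)}{|\mathcal{D}|}\right) = 0$$ has a unique solution $s \in (0,+\infty)$, denoted $s_{b,\mathcal{D},1}$. Define $$z_{b,\mathcal{D}}^+ := \frac{\log|\mathcal{D}|}{\log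 b}\left(1 + \frac{\zeta_{\mathcal{D}}'(s_{b,\mathcal{D},1})}{\zeta_{\mathcal{D}}(s_{b,\mathcal{D},1})\log b}\right), \qquad z_b^+ := \max_{\mathcal{D} \in \Omega_b^*} z_{b,\mathcal{D}}^+ .$$ *)

(* Defs.v *)
From HB Require Import structures.
From mathcomp Require Import all_boot all_order all_algebra.
From mathcomp Require Import all_classical all_reals all_analysis.
From mathcomp Require Import finmap.

Set Implicit Arguments.
Unset Strict Implicit.
Unset Printing Implicit Defensive.

Import Order.TTheory GRing.Theory Num.Theory.
Import numFieldNormedType.Exports.

Local Open Scope classical_set_scope.
Local Open Scope ring_scope.

Definition digit (b n i : nat) : nat := ((n %/ b ^ i) %% b)%N.

(* For n > 0 and b > 1, n has exactly (trunc_log b n).+1 base-b digits. *)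
Definition digit_prod (b n : nat) : nat :=
  (\prod_(i < (trunc_log b n).+1) digit b n i)%N.

(* Since 0 %| n only for n = 0, a number with a digit 0 is excluded. *)
Definition zuckerman (b n : nat) : bool := ((0 < n) && (digit_prod b n %| n))%N.

Definition Zuck (R : realType) (b : nat) (x : R) : set nat :=
  [set n : nat | zuckerman b n /\ n%:R <= x].

Definition Omega (b : nat) : set {set 'I_b} :=
  [set D : {set 'I_b} |
    (forall d : 'I_b, d \in D -> (0 < d)%N) /\
    (forall s : seq 'I_b, (1 <= size s)%N -> (forall d, d \in s -> d \in D) ->
       ~~ (b %| \prod_(d <- s) (d : nat))%N)].

Arguments Omega b : clear implicits.

Definition Omega_star (b : nat) : set {set 'I_b} :=
  [set D : {set 'I_b} | D \in Omega b /\
    ~ (exists D' : {set 'I_b}, D' \in Omega b /\ D \proper D')].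

Arguments Omega_star b : clear implicits.

Section Constants.
Variables (R : realType) (b : nat).

Definition zetaD (D : {set 'I_b}) (s : R) : R :=
  \sum_(d in D) (d : nat)%:R `^ (- s).

Definition s1_equation (D : {set 'I_b}) (s : R) : Prop :=
  (s + ln #|D|%:R / ln b%:R) * (derive1 (zetaD D) s / zetaD D s)
    - ln (zetaD D s / #|D|%:R) = 0.

(* For b >= 3 and D in Omega_star b there is exactly one positive solution,
   so the default value 0 and the choice made by xget play no role. *)
Definition s1 (D : {set 'I_b}) : R :=
  xget 0 [set s : R | 0 < s /\ s1_equation D s].

Definition zD_plus (D : {set 'I_b}) : R :=
  ln #|D|%:R / ln b%:R *
  (1 + derive1 (zetaD D) (s1 D) / (zetaD D (s1 D) * ln b%:R)).

(* The maximum over the nonempty finite family Omega_star b; -oo is only the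
   neutral element of the iterated maximum, removed again by fine. *)
Definition z_plus : R :=
  fine (\big[Order.max/-oo%E]_(D : {set 'I_b} | D \in Omega_star b)
          (zD_plus D)%:E).

End Constants.

(* Main.v *)
(** Let n have N digits, all nonzero, and digit product p dividing n.  Since n
    does not end in 0, b does not divide p, so the digits occurring at least b
    times form a set in Omega, contained in some D in Omega*; the other digits
    only cost a factor polynomial in N.  There are at most (N+1)^b digit
    multisets, hence p may be fixed.  Two bounds compete.  As p divides n, the
    last k digits are determined by the others when b^k <= p, which leaves about
    |D|^(N-k) numbers.  Rankin's trick bounds the number of words with digit
    product p by p^s zeta_D(s)^N.  Writing p = b^(alpha N), the first bound
    decreases and the second increases with alpha; at s = s_{b,D,1} they cross
    at the value b^(N z_D^+). *)

Require Import Defs.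
From HB Require Import structures.
From mathcomp Require Import all_boot all_order all_algebra.
From mathcomp Require Import all_classical all_reals all_analysis.
From mathcomp Require Import finmap.
From mathcomp Require Import ring lra.

Set Implicit Arguments.
Unset Strict Implicit.
Unset Printing Implicit Defensive.

Import Order.TTheory GRing.Theory Num.Theory.
Import numFieldNormedType.Exports.

Local Open Scope classical_set_scope.
Local Open Scope ring_scope.


(** * Base-b words: digit products and digit counts *)

Definition digit_count (b M n d : nat) : nat :=
  (\sum_(i < M) (digit b n i == d))%N.

Lemma ltn_digit b n i : (0 < b)%N -> (digit b n i < b)%N.
Proof. by move=> b0; rewrite /digit ltn_mod. Qed.

Lemma digit_divX b k n i : digit b (n %/ b ^ k)%N i = digit b n (k + i).
Proof. by rewrite /digit -divnMA -expnD. Qed.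

(** Numbers below [b ^ M] are the words of length [M], leading zeros included, so this is the
    expansion of a power; the induction splits off the last digit. *)
Lemma sum_prod_digit (R : comPzSemiRingType) (x : nat -> R) b M : (0 < b)%N ->
  \sum_(n < b ^ M) \prod_(i < M) x (digit b n i) = (\sum_(d < b) x d) ^+ M.
Proof.
move=> b0; elim: M => [|M IH].
  by rewrite big_ord1 big_ord0.
rewrite -(big_mkord xpredT (fun n => \prod_(i < M.+1) x (digit b n i))).
rewrite expnSr big_nat_mul exprSr -IH big_mkord big_distrl; apply: eq_bigr => n _.
rewrite mulSn -{1}(add0n (n * b)%N) big_addn addnK big_mkord big_distrr.
apply: eq_bigr => d _; rewrite big_ord_recl mulrC /=; congr (_ * _); last first.
  by rewrite /digit divn1 addnC modnMDl modn_small.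
apply: eq_bigr => i _; rewrite -[bump 0 i]/(1 + i)%N -digit_divX expn1.
by rewrite divnDMl ?(divn_small (ltn_ord d)).
Qed.

Lemma prod_digit_count (R : comPzSemiRingType) (x : nat -> R) b M n :
  (0 < b)%N ->
  \prod_(i < M) x (digit b n i) = \prod_(d < b) x d ^+ digit_count b M n d.
Proof.
move=> b0; have lt_dig i := ltn_digit n i b0.
rewrite (partition_big (fun i : 'I_M => Ordinal (lt_dig i)) xpredT) //=.
apply: eq_bigr => d _; rewrite (eq_bigr (fun=> x d)); last first.
  by move=> i /eqP <-.
rewrite prodr_const /digit_count -sum1_card big_mkcond /=; congr (_ ^+ _).
Qed.

Lemma prod_digit_count_nat b M n : (0 < b)%N ->
  (\prod_(i < M) digit b n i = \prod_(d < b) d ^ digit_count b M n d)%N.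
Proof.
move=> b0; apply/eqP; rewrite -(eqr_nat int) !natr_prod.
rewrite (@prod_digit_count int (fun d => d%:R)) //; apply/eqP.
by apply: eq_bigr => d _; rewrite natrX.
Qed.

Lemma prod_digit_divX_le b k M n : (0 < \prod_(i < k + M) digit b n i)%N ->
  (0 < \prod_(i < M) digit b (n %/ b ^ k) i
    <= \prod_(i < k + M) digit b n i)%N.
Proof.
rewrite big_split_ord /= muln_gt0 => /andP[k0 M0].
under eq_bigr do rewrite digit_divX.
by rewrite M0 /= leq_pmull.
Qed.

Lemma digit_count_divX_le b k M n d :
  (digit_count b M (n %/ b ^ k) d <= digit_count b (k + M) n d)%N.
Proof.
rewrite /digit_count big_split_ord /=.
under eq_bigr do rewrite digit_divX.
exact: leq_addl.
Qed.

Lemma digit_count_le b M n d : (digit_count b M n d <= M)%N.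
Proof.
rewrite -[leqRHS]card_ord -sum1_card; apply: leq_sum => i _.
exact: leq_b1.
Qed.

(** * The families [Omega] and [Omega_star] *)

Lemma dvdn_exp_self b m : (0 < b)%N -> (0 < m)%N ->
  {subset primes b <= primes m} -> (b %| m ^ b)%N.
Proof.
move=> b0 m0 sub; apply/dvdn_partP => // p pb.
rewrite p_part pfactor_dvdn ?expn_gt0 ?m0 ?lognX //; last first.
  by move: pb; rewrite mem_primes => /andP[].
have := sub p pb; rewrite -logn_gt0 => lm.
apply: leq_trans (leq_pmulr _ lm).
have [pp _] : prime p /\ True by move: pb; rewrite mem_primes => /andP[].
(* Exponents of [p]: [logn p b < p ^ logn p b <= b], while [m] contributes at least one factor
   [p]. *)
rewrite (leq_trans (ltnW (ltn_expl _ (prime_gt1 pp)))) //.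
exact: dvdn_leq (pfactor_dvdnn _ _).
Qed.

(* A digit set outside Omega has a product of its digits divisible by b, and
   raising every digit to the power b already makes such a product: each prime
   exponent of b is less than b. *)
Lemma frequent_digits_Omega b (c : 'I_b -> nat) :
  (0 < b)%N -> (forall d : 'I_b, val d = 0%N -> c d = 0%N) ->
  ~~ (b %| \prod_(d < b) d ^ c d)%N ->
  [set d | (b <= c d)%N]%SET \in Omega b.
Proof.
move=> b0 c0 ndvd; rewrite in_setE; split=> [d|s _ sD].
  rewrite inE lt0n => bc; apply/eqP => /c0 cd; move: bc.
  by rewrite cd leqn0 -(negbK (b == 0)%N) -lt0n b0.
apply: contra ndvd => dvds.
set D := [set d | _]%SET in sD *.
have Dgt0 d : d \in D -> (0 < d)%N.
  rewrite inE lt0n => bc; apply/eqP => /c0 cd; move: bc.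
  by rewrite cd leqn0 -(negbK (b == 0)%N) -lt0n b0.
have m0 : (0 < \prod_(d in D) d)%N by rewrite prodn_cond_gt0.
have /dvdn_trans -> // : (b %| (\prod_(d in D) d) ^ b)%N.
  apply: dvdn_exp_self => // p.
  rewrite !mem_primes b0 m0 => /and3P[pp _ pb] /=; rewrite pp /=.
  have : (p %| \prod_(d <- s) d)%N by exact: dvdn_trans pb dvds.
  elim: s sD {dvds} => [|d s IH] sD; first by rewrite big_nil Euclid_dvd1.
  rewrite big_cons Euclid_dvdM // => /orP[pd|]; last first.
    by apply: IH => e es; apply: sD; rewrite inE es orbT.
  have dD : d \in D by apply: sD; rewrite mem_head.
  by apply: (dvdn_trans pd); rewrite (bigD1 d) //= dvdn_mulr.
rewrite [X in (_ %| X)%N](bigID (mem D)) /= dvdn_mulr //.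
have -> : ((\prod_(d in D) d) ^ b = \prod_(d in D) d ^ b)%N.
  by apply: (big_morph (fun n => n ^ b)%N) => [x y|]; rewrite ?expnMn ?exp1n.
elim/big_ind2 : _ => // [x1 x2 y1 y2|d]; first exact: dvdn_mul.
by rewrite inE => bc; rewrite dvdn_exp2l.
Qed.

Lemma Omega_sub_star b (D : {set 'I_b}) : D \in Omega b ->
  exists2 D' : {set 'I_b}, D' \in Omega_star b & D \subset D'.
Proof.
move=> DO; have [D' maxD' sub] := @maxset_exists _ (fun D => D \in Omega b) D DO.
exists D' => //; case/maxsetP: maxD' => D'O maxD'.
rewrite in_setE; split => // -[D2 [D2O /properP[sub2 [d d2 nd]]]].
by move: nd; rewrite -(maxD' D2 D2O sub2) d2.
Qed.

Lemma Omega_gt0 b (D : {set 'I_b}) (d : 'I_b) :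
  D \in Omega b -> d \in D -> (0 < d)%N.
Proof. by rewrite in_setE => -[gt0 _]; apply: gt0. Qed.

Lemma Omega_star_Omega b (D : {set 'I_b}) :
  D \in Omega_star b -> D \in Omega b.
Proof. by rewrite in_setE => -[]. Qed.

Lemma Omega_star_closed b (D : {set 'I_b}) (e : 'I_b) :
  D \in Omega_star b -> (e |: D)%SET \in Omega b -> e \in D.
Proof.
rewrite in_setE => -[_ maxD] eO; apply/negPn/negP => nD; apply: maxD.
by exists (e |: D)%SET; split => //; rewrite properUr // finset.sub1set.
Qed.

(** A factor 1 changes no product, so maximality forces the digit 1 into [D]. *)
Lemma Omega_star_has1 b (D : {set 'I_b}) (e : 'I_b) : (1 < b)%N ->
  D \in Omega_star b -> val e = 1%N -> e \in D.
Proof.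
move=> b1 Dstar e1; have DO := Omega_star_Omega Dstar.
apply: (Omega_star_closed Dstar).
move: (DO); rewrite !in_setE => -[gt0 DO']; split.
  by move=> d; rewrite !inE => /orP[/eqP->|/gt0//]; rewrite e1.
move=> s _ sD; have -> : (\prod_(d <- s) d = \prod_(d <- s | d != e) d)%N.
  rewrite (bigID (fun d => d == e)) /= big1 ?mul1n // => d /eqP ->.
  exact: e1.
(* Removing the ones may leave the empty sequence, which [Omega] does not cover; its product 1 is
   not divisible by [b]. *)
rewrite -big_filter; case E : [seq i <- s | i != e] => [|x t].
  by rewrite big_nil gtnNdvd.
rewrite -E; apply: DO'; first by rewrite E.
move=> d; rewrite mem_filter => /andP[dn /sD]; rewrite !inE.
by rewrite (negbTE dn).
Qed.

(** The set {1} is not maximal: [b - 1] is coprime to [b] and exceeds 1, so it could be added. This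
    later makes zeta'(0) negative and [#|D|] at least 2. *)
Lemma Omega_star_has2 b (D : {set 'I_b}) : (2 < b)%N ->
  D \in Omega_star b -> exists2 d : 'I_b, d \in D & (1 < d)%N.
Proof.
move=> b2 Dstar; have b1 := ltnW b2; have b0 := ltnW b1.
have DO := Omega_star_Omega Dstar.
have [/existsP[d /andP[dD d1]]|] := boolP [exists d : 'I_b, (d \in D) && (1 < d)%N].
  by exists d.
rewrite negb_exists => /forallP all1.
have D1 d : d \in D -> val d = 1%N.
  move=> dD; have := all1 d; rewrite dD /= -leqNgt => d1.
  by apply/eqP; rewrite eqn_leq d1 (Omega_gt0 DO dD).
have eb : (b.-1 < b)%N by rewrite prednK.
exists (Ordinal eb); last by rewrite /= -ltnS prednK.
apply: (Omega_star_closed Dstar); rewrite in_setE; split.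
  move=> d; rewrite !inE => /orP[/eqP -> /=|/D1 ->//].
  by rewrite -ltnS prednK // ltnW.
move=> s _ sD.
suff cop : coprime b (\prod_(d <- s) d).
  apply/negP => dv; move: cop.
  by rewrite /coprime; move/gcdn_idPl: dv => ->; rewrite gtn_eqF.
elim: s sD => [|d s IH] sD; first by rewrite big_nil coprimen1.
rewrite big_cons coprimeMr IH ?andbT; last first.
  by move=> e es; apply: sD; rewrite inE es orbT.
have := sD d (mem_head _ _); rewrite !inE => /orP[/eqP -> /=|/D1 ->]; last first.
  exact: coprimen1.
by rewrite -{1}(prednK b0) coprimeSn.
Qed.

(** * Dirichlet polynomials and the equation defining [s1] *)

Lemma natpowRE (R : realType) (d : nat) (s : R) : (0 < d)%N ->
  d%:R `^ s = expR (s * ln d%:R).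
Proof. by move=> d0; rewrite /powR pnatr_eq0 gtn_eqF. Qed.

(** Free coefficients [a] cover both zeta ([a d = 1]) and its derivative ([a d = - ln d]), whose
    continuity is also required. *)
Lemma is_derive_dirichlet (R : realType) b (D : {set 'I_b}) (a : 'I_b -> R) (s : R) :
  (forall d : 'I_b, d \in D -> (0 < d)%N) ->
  is_derive s 1 (fun t : R => \sum_(d in D) a d * (d : nat)%:R `^ (- t))
    (\sum_(d in D) a d * - ln (d : nat)%:R * (d : nat)%:R `^ (- s)).
Proof.
move=> Dgt0.
pose h (d : 'I_b) (t : R) : R :=
  if d \in D then a d * expR (- t * ln (d : nat)%:R) else 0.
pose dh (d : 'I_b) : R :=
  if d \in D then a d * (expR (- s * ln (d : nat)%:R) * - ln (d : nat)%:R)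
  else 0.
have -> : (fun t => \sum_(d in D) a d * (d : nat)%:R `^ (- t)) =
    \sum_(d < b) h d.
  apply/funext => t; rewrite fct_sumE big_mkcond; apply: eq_bigr => d _.
  by rewrite /h; case: ifP => // dD; rewrite natpowRE ?Dgt0.
have -> : \sum_(d in D) a d * - ln (d : nat)%:R * (d : nat)%:R `^ (- s) =
    \sum_(d < b) dh d.
  rewrite big_mkcond; apply: eq_bigr => d _; rewrite /dh; case: ifP => // dD.
  by rewrite natpowRE ?Dgt0 // -!mulrA; congr (_ * _); rewrite mulrC.
apply: is_derive_sum => d; rewrite /h /dh; case: (d \in D); last exact: is_derive_cst.
have Hlin : is_derive s 1 (fun t : R => - t * ln (d : nat)%:R) (- ln (d : nat)%:R).
  have -> : (fun t : R => - t * ln (d : nat)%:R) = (- ln (d : nat)%:R) \*: (@id R).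
    by apply/funext => t /=; rewrite /GRing.scale /= mulNr mulrC mulNr.
  by apply: is_derive_eq; rewrite /GRing.scale /= mulr1.
have Hexp := @is_derive1_comp R expR (fun t : R => - t * ln (d : nat)%:R) _ _ _
  (is_derive_expR _) Hlin.
exact: is_deriveZ.
Qed.

Lemma continuous_dirichlet (R : realType) b (D : {set 'I_b}) (a : 'I_b -> R) :
  (forall d : 'I_b, d \in D -> (0 < d)%N) ->
  continuous (fun t : R => \sum_(d in D) a d * (d : nat)%:R `^ (- t)).
Proof.
move=> Dgt0 s; apply: differentiable_continuous; apply/derivable1_diffP.
by case: (is_derive_dirichlet a s Dgt0).
Qed.

Section ZetaD.
Variables (R : realType) (b : nat) (D : {set 'I_b}).
Hypotheses (b_gt2 : (2 < b)%N) (Dstar : D \in Omega_star b).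
Local Notation zeta := (@zetaD R b D).

Let Dgt0 (d : 'I_b) : d \in D -> (0 < d)%N.
Proof. exact: Omega_gt0 (Omega_star_Omega Dstar). Qed.

Lemma zetaD_eq : zeta = fun s => \sum_(d in D) 1 * (d : nat)%:R `^ (- s).
Proof. by apply/funext => s; apply: eq_bigr => d _; rewrite mul1r. Qed.

Lemma derive1_zetaD :
  derive1 zeta = fun s => \sum_(d in D) - ln (d : nat)%:R * (d : nat)%:R `^ (- s).
Proof.
apply/funext => s; rewrite derive1E zetaD_eq.
have [_ ->] := is_derive_dirichlet (fun=> 1) s Dgt0.
by apply: eq_bigr => d _; rewrite mul1r.
Qed.

Lemma continuous_zetaD : continuous zeta.
Proof. by rewrite zetaD_eq; exact: continuous_dirichlet. Qed.

Lemma continuous_derive1_zetaD : continuous (derive1 zeta).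
Proof. by rewrite derive1_zetaD; exact: continuous_dirichlet. Qed.

Let e1 : 'I_b := Ordinal (ltnW b_gt2).
Let De1 : e1 \in D. Proof. exact: (Omega_star_has1 (ltnW b_gt2) Dstar). Qed.

Lemma zetaD_ge1 s : 1 <= zeta s.
Proof.
rewrite /zetaD (bigD1 e1) //= powR1 lerDl; apply: sumr_ge0 => d _.
exact: powR_ge0.
Qed.

Lemma zetaD0 : zeta 0 = #|D|%:R.
Proof.
rewrite /zetaD (eq_bigr (fun=> 1)) ?sumr_const // => d _.
by rewrite oppr0 powRr0.
Qed.

Lemma derive1_zetaD_le0 s : derive1 zeta s <= 0.
Proof.
rewrite derive1_zetaD; apply: sumr_le0 => d dD.
by rewrite mulNr oppr_le0 mulr_ge0 ?powR_ge0 // ln_ge0 // ler1n Dgt0.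
Qed.

Lemma derive1_zetaD0_lt0 : derive1 zeta 0 < 0.
Proof.
rewrite derive1_zetaD; have [d dD d1] := Omega_star_has2 b_gt2 Dstar.
rewrite (bigD1 d) //= oppr0 powRr0 mulr1 ltr_wnDr ?oppr_lt0 ?ln_gt0 ?ltr1n //.
apply: sumr_le0 => e /andP[eD _].
by rewrite mulNr oppr_le0 mulr_ge0 ?powR_ge0 // ln_ge0 // ler1n Dgt0.
Qed.

Lemma card_Omega_star_gt1 : (1 < #|D|)%N.
Proof.
have [d dD d1] := Omega_star_has2 b_gt2 Dstar.
rewrite (cardD1 e1) De1 (cardD1 d) !inE dD andbT.
by rewrite (_ : d != e1) // -val_eqE /= gtn_eqF.
Qed.

Let lnb_gt0 : 0 < ln (b%:R : R).
Proof. by rewrite ln_gt0 // ltr1n ltnW. Qed.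

Let lnD_gt0 : 0 < ln (#|D|%:R : R).
Proof. by rewrite ln_gt0 // ltr1n card_Omega_star_gt1. Qed.

Let zeta_gt0 s : 0 < zeta s. Proof. exact: lt_le_trans (zetaD_ge1 s). Qed.

(** The digit 1 contributes nothing to zeta' and exactly the subtracted 1 to zeta. Every other digit
    is at least 2, so what remains decays like [2 ^ -s] up to a linear factor. *)
Lemma zetaD_tail_le (a s : R) : 0 <= s -> 0 <= a ->
  - ((s + a) * derive1 zeta s) + (zeta s - 1)
    <= b%:R * ((s + a + 1) * (ln b%:R + 1) * 2 `^ (- s)).
Proof.
move=> s0 a0; set K := (s + a + 1) * _ * _.
have lnb0 := ltW lnb_gt0.
have K0 : 0 <= K.
  by rewrite /K !mulr_ge0 ?powR_ge0 // ?addr_ge0.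
rewrite derive1_zetaD /zetaD -mulrN -sumrN mulr_sumr.
rewrite (bigD1 e1) //= ln1 oppr0 mul0r oppr0 mulr0 add0r.
rewrite [X in X - 1](bigD1 e1) //= powR1 addrAC subrr add0r -big_split /=.
rewrite mulr_natl -[X in K *+ X](card_ord b) -sumr_const big_mkcond /=.
apply: ler_sum => d _; case: ifP => // /andP[dD dn1].
have d2 : (1 < d)%N.
  rewrite ltn_neqAle Dgt0 // andbT eq_sym.
  by move: dn1; rewrite -val_eqE.
have lnd0 : 0 <= ln (d : nat)%:R :> R by rewrite ln_ge0 // ler1n Dgt0.
have lnd : ln (d : nat)%:R <= ln b%:R :> R.
  by rewrite ler_ln ?posrE ?ltr0n ?Dgt0 ?ler_nat ?(ltnW (ltn_ord d)) // ltnW // ltnW.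
have pd : (d : nat)%:R `^ (- s) <= 2 `^ (- s) :> R.
  rewrite !powRN lef_pV2 ?posrE ?powR_gt0 ?ltr0n ?Dgt0 //.
  by rewrite ge0_ler_powR ?nnegrE ?ler0n ?ler_nat.
have -> : (s + a) * - (- ln (d : nat)%:R * (d : nat)%:R `^ (- s)) +
    (d : nat)%:R `^ (- s) =
    ((s + a) * ln (d : nat)%:R + 1) * (d : nat)%:R `^ (- s) :> R by ring.
have sa : 0 <= s + a by rewrite addr_ge0.
apply: ler_pM => //; first by rewrite addr_ge0 ?mulr_ge0.
by nra.
Qed.

(* At 0 the function has the sign of zeta'(0) < 0; at infinity it tends to
   ln |D| > 0, because the digit 1 in D makes zeta tend to 1. *)
Lemma s1_equation_solvable : exists2 s : R, 0 < s & s1_equation D s.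
Proof.
set c := ln (#|D|%:R : R) / ln b%:R.
have c0 : 0 < c by rewrite divr_gt0.
have n0 : 0 < #|D|%:R :> R by rewrite ltr0n ltnW // card_Omega_star_gt1.
pose f s := (s + c) * (derive1 zeta s / zeta s) - ln (zeta s / #|D|%:R).
have f0 : f 0 < 0.
  rewrite /f zetaD0 divff ?gt_eqF // ln1 subr0 add0r.
  by rewrite pmulr_rlt0 // ltr_pdivrMr // mul0r derive1_zetaD0_lt0.
have [T T0 fT] : exists2 T, 0 <= T & 0 < f T.
  have l2 : 0 < ln 2 :> R by rewrite ln_gt0 // ltr1n.
  (* With [T = 2 t / ln 2], [2 ^ -T = expR (- 2 t)] is at most [(1 + t) ^ -2], while
     [T + c + 1 <= (1 + t) q]. The tail is then at most [K / (1 + t)], and [t = K / ln #|D|] puts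
     this below [ln #|D|]. *)
  pose q := 2 / ln 2 + c + 1.
  pose K := b%:R * (q * (ln b%:R + 1)).
  have q0 : 0 < q by rewrite /q !addr_gt0 ?divr_gt0.
  have K0 : 0 < K.
    have b0 : 0 < b%:R :> R by rewrite ltr0n (ltnW (ltnW b_gt2)).
    by apply: mulr_gt0 => //; apply: mulr_gt0 => //; apply: addr_gt0.
  pose t := K / ln #|D|%:R; have t0 : 0 < t by rewrite divr_gt0.
  pose T := t * (2 / ln 2).
  have T0 : 0 <= T by rewrite mulr_ge0 ?divr_ge0 ?ltW.
  exists T => //.
  have e2 : 2 `^ (- T) <= ((1 + t) ^+ 2)^-1 :> R.
    rewrite (natpowRE _ (isT : 0 < 2)%N) mulNr expRN lef_pV2 ?posrE ?expR_gt0 //; last first.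
      by rewrite exprn_gt0 // addr_gt0.
    have -> : T * ln 2 = 2%:R * t by rewrite /T; field; rewrite gt_eqF.
    by rewrite expRM_natl lerXn2r ?nnegrE ?expR_ge0 ?addr_ge0 ?expR_ge1Dx ?ltW.
  have Tq : T + c + 1 <= (1 + t) * q.
    rewrite -subr_ge0.
    have -> : (1 + t) * q - (T + c + 1) = 2 / ln 2 + t * (c + 1).
      by rewrite /q /T; ring.
    apply: addr_ge0; first by apply: ltW; apply: divr_gt0.
    by apply: mulr_ge0; [exact: ltW|apply: addr_ge0 => //; exact: ltW].
  have tail := zetaD_tail_le T0 (ltW c0).
  have bnd : b%:R * ((T + c + 1) * (ln b%:R + 1) * 2 `^ (- T)) < ln (#|D|%:R : R).
    apply: (@le_lt_trans _ _ (b%:R * ((1 + t) * q * (ln b%:R + 1) * ((1 + t) ^+ 2)^-1))).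
      have lb1 : 0 <= ln b%:R + 1 :> R by rewrite addr_ge0 ?ltW.
      have Tc1 : 0 <= T + c + 1 by rewrite !addr_ge0 // ltW.
      rewrite ler_wpM2l //; apply: ler_pM => //; first exact: mulr_ge0.
      exact: ler_wpM2r.
    have -> : b%:R * ((1 + t) * q * (ln b%:R + 1) * ((1 + t) ^+ 2)^-1) = K / (1 + t).
      by rewrite /K; field; rewrite gt_eqF // addr_gt0.
    rewrite ltr_pdivrMr ?addr_gt0 // mulrDr mulr1 /t [X in _ < _ + X]mulrC divfK ?gt_eqF //.
    by rewrite ltrDr.
  (* As zeta >= 1 and zeta' <= 0, dividing zeta' by zeta only shrinks it in absolute value. With
     [ln z <= z - 1], what [f T] subtracts from [ln #|D|] is at most the tail. *)
  have dz : - ((T + c) * derive1 zeta T) >= - ((T + c) * (derive1 zeta T / zeta T)).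
    rewrite lerN2 mulrA ler_pdivlMr // ler_neMr ?zetaD_ge1 //.
    by rewrite mulr_ge0_le0 ?derive1_zetaD_le0 ?addr_ge0 // ltW.
  have lz : ln (zeta T) <= zeta T - 1.
    have {1}-> : zeta T = 1 + (zeta T - 1) by rewrite addrC subrK.
    by apply: le_ln1Dx; have := zeta_gt0 T; lra.
  rewrite /f ln_div ?posrE //; lra.
have cf : continuous f.
  move=> s; apply: cvgB.
    apply: cvgM; first by apply: cvgD; [exact: cvg_id|exact: cvg_cst].
    apply: cvgM; first exact: continuous_derive1_zetaD.
    by apply: cvgV; [rewrite gt_eqF|exact: continuous_zetaD].
  apply: continuous_cvg; first by apply: continuous_ln; rewrite divr_gt0.
  by apply: cvgM; [exact: continuous_zetaD|exact: cvg_cst].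
have [||s /[!in_itv] /= /andP[s0 _] fs] := @IVT _ f 0 T 0 T0.
- exact: continuous_subspaceT.
- by rewrite ge_min le_max (ltW f0) (ltW fT) orbT.
(* The intermediate value theorem allows [s = 0]; [f 0 < 0] excludes it. *)
exists s => //; rewrite lt_neqAle s0 andbT; apply/eqP => s00.
by subst s; rewrite fs ltxx in f0.
Qed.

(* With [alpha = - zeta'(s) / (zeta(s) ln b)] the equation defining [s1] says
   that both bounds [|D|^(1 - alpha)] and [b^(alpha s) zeta(s)] equal [b^z]. *)
Lemma zD_plusE : exists s alpha : R,
  [/\ 0 <= s, zD_plus R D * ln b%:R = alpha * s * ln b%:R + ln (zeta s),
      zD_plus R D * ln b%:R = (1 - alpha) * ln #|D|%:R & 0 <= zD_plus R D].
Proof.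
have [s0 eqs] : 0 < s1 R D /\ s1_equation D (s1 R D).
  (* Since a solution exists, [xget] returns a solution and not its default 0. *)
  have [s s0 es] := s1_equation_solvable.
  by apply: (@xgetPex _ 0 [set s : R | 0 < s /\ s1_equation D s]); exists s.
have n0 : 0 < #|D|%:R :> R by rewrite ltr0n ltnW // card_Omega_star_gt1.
set s := s1 R D in s0 eqs *.
pose alpha := - derive1 zeta s / (zeta s * ln b%:R).
have zE : zD_plus R D = ln #|D|%:R / ln b%:R * (1 - alpha).
  by rewrite /zD_plus -/s /alpha mulNr opprK.
have lb0 : ln (b%:R : R) != 0 by rewrite gt_eqF.
have zE2 : zD_plus R D * ln b%:R = (1 - alpha) * ln #|D|%:R.
  by rewrite zE; field.
have zE1 : zD_plus R D * ln b%:R = alpha * s * ln b%:R + ln (zeta s).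
  rewrite zE2; move: eqs; rewrite /s1_equation ln_div ?posrE //.
  have -> : derive1 zeta s / zeta s = - alpha * ln b%:R.
    by rewrite /alpha; field; rewrite lb0 gt_eqF.
  have -> : (s + ln #|D|%:R / ln b%:R) * (- alpha * ln b%:R) =
    - (alpha * s * ln b%:R) - alpha * ln #|D|%:R by field.
  lra.
exists s, alpha; split => //; first exact: ltW.
rewrite -(pmulr_lge0 _ lnb_gt0) zE1 addr_ge0 ?ln_ge0 ?zetaD_ge1 //.
apply: mulr_ge0; last exact: ltW.
apply: mulr_ge0; last exact: ltW.
by rewrite divr_ge0 ?oppr_ge0 ?derive1_zetaD_le0 // mulr_ge0 ?ltW.
Qed.

End ZetaD.

(** * The maximum [z_plus] *)

Lemma zD_plus_le_z_plus (R : realType) b (D : {set 'I_b}) :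
  D \in Omega_star b -> zD_plus R D <= z_plus R b.
Proof.
move=> Dstar; rewrite -lee_fin /z_plus fineK; last first.
  (* The iterated maximum is finite, so [fine] keeps its value: it is at least the real value at
     [D], and a maximum of reals and [-oo] stays below [+oo]. *)
  rewrite fin_numE; apply/andP; split.
    rewrite gt_eqF // (lt_le_trans _ (le_bigmax_cond _ _ Dstar)) //.
    exact: ltNyr.
  rewrite lt_eqF //; elim/big_ind: _ => // [x y xoo yoo|E _].
    by rewrite gt_max xoo yoo.
  exact: ltry.
exact: (le_bigmax_cond _ (fun D => (zD_plus R D)%:E) Dstar).
Qed.

(** The empty set lies in [Omega b] and extends to a maximal set, so there is a term, and it is
    nonnegative. The sign makes the final bound monotone in the number of digits. *)
Lemma z_plus_ge0 (R : realType) b : (2 < b)%N -> 0 <= z_plus R b.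
Proof.
move=> b2; have O0 : finset.set0 \in Omega b.
  rewrite in_setE; split=> [d|[//|d s] _ /(_ d (mem_head _ _))]; by rewrite inE.
have [D Dstar _] := Omega_sub_star O0.
have [s [alpha [_ _ _ z0]]] := zD_plusE R b2 Dstar.
exact: le_trans z0 (zD_plus_le_z_plus R Dstar).
Qed.

(** * Rankin's trick for words with few digits outside [D] *)

Lemma natr_prod_powR (R : realType) n (a : 'I_n -> nat) (r : R) :
  \prod_(i < n) (a i)%:R `^ r = (\prod_(i < n) a i)%N%:R `^ r.
Proof.
rewrite natr_prod.
suff [] : \prod_(i < n) (a i)%:R `^ r = (\prod_(i < n) (a i)%:R) `^ r /\
  0 <= \prod_(i < n) (a i)%:R :> R by [].
elim/big_rec2 : _ => [|i x y _ [-> y0]]; first by rewrite powR1.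
by rewrite powRM ?mulr_ge0.
Qed.

(* Rankin's trick: a number with digits d_i gets the weight prod x(d_i) with
   x(d) = d^(-s) on D and x(d) = 1/N off D.  The weights of all M-digit words
   sum to (zeta_D(s) + O(b/N))^M, whereas each element of U weighs at least
   p^(-s) N^(-b^2). *)
Lemma card_rankin (R : realType) b N M (D : {set 'I_b}) (s : R) (p : nat)
    (U : {set 'I_(b ^ M)}) :
  (0 < b)%N -> (0 < N)%N -> (M <= N)%N -> 0 <= s -> 1 <= zetaD D s ->
  (forall u, u \in U -> (0 < \prod_(i < M) digit b u i <= p)%N) ->
  (forall u (d : 'I_b), u \in U -> d \notin D -> (digit_count b M u d <= b)%N) ->
  #|U|%:R <= p%:R `^ s * N%:R ^+ (b * b) * (expR b%:R * zetaD D s ^+ M).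
Proof.
move=> b0 N0 MN s0 z1 Up Uc.
have [->|[u0 u0U]] := set_0Vmem U.
  by rewrite cards0 !mulr_ge0 ?powR_ge0 ?expR_ge0 ?exprn_ge0 // (le_trans _ z1).
have p0 : (0 < p)%N by have /andP[a0 /(leq_trans a0)] := Up _ u0U.
have N0' : 0 < N%:R :> R by rewrite ltr0n.
pose inD (d : nat) := d \in [seq val e | e in D].
have inDE (e : 'I_b) : inD (val e) = (e \in D).
  by rewrite /inD (fintype.mem_image val_inj).
(* [y] isolates the penalty for digits off [D]: for nonzero [d], [d ^ (- s) * y d <= x d], and the
   products of the two factors are estimated separately. *)
pose y d : R := if inD d then 1 else N%:R^-1.
pose x d : R := if inD d then d%:R `^ (- s) else N%:R^-1.
have y0 d : 0 <= y d by rewrite /y; case: ifP => // _; rewrite invr_ge0.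
have x0 d : 0 <= x d.
  by rewrite /x; case: ifP => _; rewrite ?powR_ge0 // invr_ge0.
(* The hypothesis [1 <= zetaD D s] turns the additive [b / N] into a factor
   [1 + b / N <= expR (b / N)], whose [M]-th power is at most [expR b] because [M <= N]. *)
have sumx : \sum_(d < b) x d <= zetaD D s * expR (b%:R / N%:R).
  apply: (@le_trans _ _ (zetaD D s + b%:R / N%:R)).
    have -> : b%:R / N%:R = \sum_(d < b) N%:R^-1 :> R.
      by rewrite sumr_const card_ord mulr_natl.
    rewrite /zetaD [X in _ <= X + _]big_mkcond -big_split /=.
    apply: ler_sum => d _; rewrite /x inDE; case: ifP => _.
      by rewrite lerDl invr_ge0.
    by rewrite add0r.
  apply: (@le_trans _ _ (zetaD D s * (1 + b%:R / N%:R))).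
    by rewrite mulrDr mulr1 lerD2l ler_peMl // divr_ge0.
  by rewrite ler_wpM2l ?expR_ge1Dx // (le_trans _ z1).
have total : \sum_(u < b ^ M) \prod_(i < M) x (digit b u i) <=
    expR b%:R * zetaD D s ^+ M.
  rewrite sum_prod_digit //.
  apply: (@le_trans _ _ ((zetaD D s * expR (b%:R / N%:R)) ^+ M)).
    by rewrite lerXn2r ?nnegrE ?sumr_ge0 // mulr_ge0 ?expR_ge0 // (le_trans _ z1).
  rewrite exprMn mulrC ler_wpM2r ?exprn_ge0 ?(le_trans _ z1) //.
  rewrite -expRM_natl ler_expR mulrCA ler_piMr //.
  by rewrite ler_pdivrMr // mul1r ler_nat.
have lower u : u \in U -> (p%:R `^ s * N%:R ^+ (b * b))^-1 <=
    \prod_(i < M) x (digit b u i).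
  move=> uU; have /andP[P0 Pp] := Up u uU.
  apply: (@le_trans _ _ (\prod_(i < M) ((digit b u i)%:R `^ (- s) * y (digit b u i)))).
    rewrite big_split /= natr_prod_powR (prod_digit_count y) // invfM.
    apply: ler_pM; rewrite ?invr_ge0 ?powR_ge0 ?exprn_ge0 //.
      rewrite powRN lef_pV2 ?posrE ?powR_gt0 ?ltr0n //.
      by rewrite ge0_ler_powR ?nnegrE ?ler_nat.
    (* Each of the [b] digit values costs at most [N ^ b]: a digit off [D] occurs at most [b] times,
       a digit in [D] costs nothing. *)
    rewrite exprM -exprVn -[X in _ ^+ X](card_ord b) -prodr_const.
    apply: ler_prod => d _; rewrite invr_ge0 exprn_ge0 //=.
    have iN : N%:R^-1 <= 1 :> R by rewrite invf_le1 ?ler1n.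
    rewrite /y inDE; case: ifPn => [dD|dD].
      by rewrite expr1n -exprVn exprn_ile1 ?invr_ge0.
    by rewrite -exprVn ler_wiXn2l ?invr_ge0 // Uc.
  have dig0 (i : 'I_M) : (0 < digit b u i)%N.
    by rewrite lt0n; apply: contraTneq P0 => d0; rewrite (bigD1 i) //= d0.
  apply: ler_prod => i _; rewrite mulr_ge0 ?powR_ge0 //= /x /y.
  case: ifP => _; first by rewrite mulr1.
  rewrite ler_piMl ?invr_ge0 // powRN invf_le1 ?powR_gt0 ?ltr0n //.
  by apply: le_trans (ler_powR _ s0); rewrite ?powRr0 ?ler1n ?dig0.
have LB0 : 0 < p%:R `^ s * N%:R ^+ (b * b) :> R.
  by rewrite mulr_gt0 ?powR_gt0 ?exprn_gt0 ?ltr0n.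
rewrite -ler_pdivrMl // mulrC mulr_natl -sumr_const.
apply: le_trans (ler_sum _ lower) _; apply: le_trans total.
rewrite [leRHS](bigID (mem U)) /= lerDl; apply: sumr_ge0 => u _.
by apply: prodr_ge0.
Qed.

(** * Zuckerman numbers with prescribed digit counts *)

Section Class.
Variables (R : realType) (b N : nat) (c : 'I_b -> nat).
Hypotheses (b_gt2 : (2 < b)%N) (N_gt0 : (0 < N)%N).

(** The positive product excludes leading zeros, so members have exactly [N] digits; the counts [c]
    fix the digit product. *)
Definition zuck_class : {set 'I_(b ^ N)} :=
  [set n : 'I_(b ^ N) | [&& (0 < \prod_(i < N) digit b n i)%N,
     (\prod_(i < N) digit b n i %| n)%N &
     [forall d : 'I_b, digit_count b N n d == c d]]]%SET.

Let b_gt0 : (0 < b)%N. Proof. exact: ltnW (ltnW b_gt2). Qed.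

Lemma zuck_class_count n (d : 'I_b) : n \in zuck_class ->
  digit_count b N n d = c d.
Proof. by rewrite inE => /and3P[_ _ /forallP/(_ d)/eqP]. Qed.

Lemma zuck_class_prod n : n \in zuck_class ->
  (\prod_(i < N) digit b n i = \prod_(d < b) d ^ c d)%N.
Proof.
move=> nC; rewrite prod_digit_count_nat //; apply: eq_bigr => d _.
by rewrite zuck_class_count.
Qed.

(** The last digit is nonzero, so [b] divides neither [n] nor its digit product. The conclusion
    mentions only [c], so the [D] found from one member serves the whole class. *)
Lemma zuck_class_star n : n \in zuck_class ->
  exists2 D : {set 'I_b}, D \in Omega_star b &
    forall d : 'I_b, d \notin D -> (c d <= b)%N.
Proof.
move=> nC; have := nC; rewrite inE => /and3P[P0 Pn _].
have dig0 i : (i < N)%N -> (0 < digit b n i)%N.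
  move=> iN; rewrite lt0n; apply: contraTneq P0 => d0.
  by rewrite (bigD1 (Ordinal iN)) //= d0.
have c0 (d : 'I_b) : val d = 0%N -> c d = 0%N.
  move=> d0; rewrite -(zuck_class_count d nC) /digit_count big1 // => i _.
  by rewrite -[d : nat]/(val d) d0 gtn_eqF ?dig0.
have ndvd : ~~ (b %| \prod_(d < b) d ^ c d)%N.
  rewrite -(zuck_class_prod nC); apply/negP => /dvdn_trans/(_ Pn).
  rewrite /dvdn => /eqP bn; have := dig0 0%N N_gt0.
  by rewrite /digit expn0 divn1 bn.
have [D Dstar sub] := Omega_sub_star (frequent_digits_Omega b_gt0 c0 ndvd).
exists D => // d dD; rewrite leqNgt; apply: contra dD => /ltnW bc.
by apply: (fintype.subsetP sub); rewrite inE.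
Qed.

(* Writing n = u b^k + v with v < b^k <= P, the leading part u determines n,
   because P divides n. *)
Lemma card_zuck_class_lead (p k : nat) (D : {set 'I_b}) :
  p = (\prod_(d < b) d ^ c d)%N -> (b ^ k <= p)%N -> (k <= N)%N ->
  1 <= #|D|%:R :> R ->
  (forall d : 'I_b, d \notin D -> (c d <= b)%N) ->
  #|zuck_class|%:R <= N%:R ^+ (b * b) * (expR b%:R * #|D|%:R ^+ (N - k)) :> R.
Proof.
move=> pE kp kN D1 Dc.
have lt_lead (n : 'I_(b ^ N)) : (n %/ b ^ k < b ^ (N - k))%N.
  by rewrite ltn_divLR ?expn_gt0 ?b_gt0 // -expnD subnK.
pose f n := Ordinal (lt_lead n).
have finj : {in zuck_class &, injective f}.
  move=> m n mC nC /(congr1 val) /= mn; apply: val_inj => /=.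
  have dvd q : q \in zuck_class -> (p %| q)%N.
    by move=> qC; rewrite pE -(zuck_class_prod qC); move: qC; rewrite inE => /and3P[].
  wlog le_mn : m n mC nC mn / (m <= n)%N.
    move=> W; have [/W|/ltnW /W] := leqP m n; first exact.
    by move=> /(_ nC mC (esym mn)).
  apply/eqP; rewrite eqn_leq le_mn /= -subn_eq0; apply/negPn/negP.
  rewrite -lt0n => /dvdn_leq/(_ (dvdn_sub (dvd _ nC) (dvd _ mC))).
  rewrite leqNgt => /negP; apply; apply: leq_trans kp.
  rewrite (divn_eq n (b ^ k)) (divn_eq m (b ^ k)) mn subnDl.
  by apply: leq_ltn_trans (leq_subr _ _) _; rewrite ltn_mod expn_gt0 b_gt0.
rewrite -(card_in_imset finj).
(* At [s = 0] the Rankin bound simply counts words with few digits off [D]; it is applied to the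
   leading parts, of length [N - k]. *)
have z0 : zetaD D 0 = #|D|%:R :> R.
  rewrite /zetaD (eq_bigr (fun=> 1)) ?sumr_const // => d _.
  by rewrite oppr0 powRr0.
have := @card_rankin R b N (N - k) D 0 p (f @: zuck_class)%SET b_gt0 N_gt0 (leq_subr _ _) (lexx _).
rewrite z0 powRr0 mul1r; apply=> // [u /imsetP[n nC ->]|u d /imsetP[n nC ->] dD].
  rewrite /= pE -(zuck_class_prod nC).
  have := @prod_digit_divX_le b k (N - k) n; rewrite subnKC //; apply.
  by move: nC; rewrite inE => /and3P[].
apply: leq_trans (Dc d dD); rewrite -(zuck_class_count d nC).
by have := digit_count_divX_le b k (N - k) n d; rewrite subnKC.
Qed.

Lemma card_zuck_class_prod (p : nat) (D : {set 'I_b}) (s : R) :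
  p = (\prod_(d < b) d ^ c d)%N -> 0 <= s -> 1 <= zetaD D s ->
  (forall d : 'I_b, d \notin D -> (c d <= b)%N) ->
  #|zuck_class|%:R <=
    p%:R `^ s * N%:R ^+ (b * b) * (expR b%:R * zetaD D s ^+ N).
Proof.
move=> pE s0 z1 Dc; apply: card_rankin => // [u uC|u d uC dD].
  by rewrite pE -(zuck_class_prod uC) leqnn andbT; move: uC; rewrite inE => /and3P[].
by rewrite (zuck_class_count d uC) Dc.
Qed.

Lemma card_zuck_class :
  #|zuck_class|%:R <= N%:R ^+ (b * b) *
    (expR b%:R * b%:R * expR (N%:R * (z_plus R b * ln b%:R))).
Proof.
have [->|[n nC]] := set_0Vmem zuck_class.
  by rewrite cards0 !mulr_ge0 ?expR_ge0 ?exprn_ge0.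
have [D Dstar Dc] := zuck_class_star nC.
have [s [alpha [s0 zE1 zE2 _]]] := zD_plusE R b_gt2 Dstar.
have z1 := zetaD_ge1 b_gt2 Dstar s.
have D1 : 1 <= #|D|%:R :> R by rewrite ler1n ltnW // card_Omega_star_gt1.
have lnb0 : 0 < ln b%:R :> R by rewrite ln_gt0 // ltr1n ltnW.
have b1 : 1 <= b%:R :> R by rewrite ler1n.
have zle : N%:R * (zD_plus R D * ln b%:R) <= N%:R * (z_plus R b * ln b%:R) :> R.
  by rewrite ler_wpM2l // ler_wpM2r ?(ltW lnb0) // zD_plus_le_z_plus.
have [p pE] : exists p, p = (\prod_(d < b) d ^ c d)%N by eexists.
have pn : p = (\prod_(i < N) digit b n i)%N by rewrite pE -(zuck_class_prod nC).
have p0 : (0 < p)%N by rewrite pn; move: nC; rewrite inE => /and3P[].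
have pn_le : (p <= n)%N.
  apply: dvdn_leq; last by rewrite pn; move: nC; rewrite inE => /and3P[].
  rewrite lt0n; apply: contraTneq p0 => n0; rewrite pn n0.
  by rewrite (bigD1 (Ordinal N_gt0)) //= /digit div0n mod0n.
have bnd := card_zuck_class_prod pE s0 z1 Dc.
(* The threshold [p = b ^ (alpha N)] is where the two bounds meet. Below it Rankin's bound suffices,
   as [p ^ s <= b ^ (alpha s N)]. *)
have [small|large] := lerP (ln p%:R) (alpha * N%:R * ln b%:R).
  apply: le_trans bnd _.
  rewrite -mulrA mulrCA ler_wpM2l ?exprn_ge0 //.
  rewrite mulrCA -[leRHS]mulrA ler_wpM2l ?expR_ge0 //.
  rewrite natpowRE // -{1}(lnK (x := zetaD D s)) ?posrE ?(lt_le_trans _ z1) //.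
  rewrite -expRM_natl -expRD -[leLHS]mul1r; apply: ler_pM; rewrite ?expR_ge0 // ler_expR.
  apply: le_trans zle; rewrite zE1.
  have := ler_wpM2l s0 small; nra.
(* The largest [k] with [b ^ k <= p] satisfies [alpha N <= k + 1]. The extra 1 costs a factor
   [#|D| <= b], whence the factor [b] in the bound. *)
pose k := trunc_log b p.
have /andP[kp pk] := trunc_log_bounds (ltnW b_gt2) p0.
have kN : (k <= N)%N.
  rewrite -(leq_exp2l _ _ (ltnW b_gt2)); apply: leq_trans kp _.
  exact: leq_trans pn_le (ltnW (ltn_ord n)).
apply: le_trans (card_zuck_class_lead pE kp kN D1 Dc) _.
rewrite ler_wpM2l ?exprn_ge0 // -mulrA ler_wpM2l ?expR_ge0 //.
have lnD0 : 0 <= ln #|D|%:R :> R by rewrite ln_ge0.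
have lnDb : ln #|D|%:R <= ln b%:R :> R.
  rewrite ler_ln ?posrE ?ltr0n ?b_gt0 ?ler_nat //; last first.
    by rewrite -(ltr0n R) (lt_le_trans _ D1).
  by rewrite -[leqRHS]card_ord max_card.
rewrite -{1}(lnK (x := #|D|%:R)) ?posrE ?(lt_le_trans _ D1) //.
rewrite -{1}(lnK (x := b%:R)) ?posrE ?(lt_le_trans _ b1) //.
rewrite -expRM_natl -expRD ler_expR.
suff : (N - k)%:R * ln #|D|%:R <= ln b%:R + N%:R * (zD_plus R D * ln b%:R) :> R.
  by move=> /le_trans; apply; rewrite lerD2l.
rewrite zE2 natrB //.
have kbig : alpha * N%:R <= k%:R + 1.
  rewrite -(ler_pM2r lnb0) (le_trans (ltW large)) //.
  have -> : k%:R + 1 = k.+1%:R :> R by rewrite -natr1.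
  have -> : k.+1%:R * ln b%:R = ln (b ^ k.+1)%:R :> R.
    by rewrite natrX lnXn ?ltr0n // mulr_natl.
  by rewrite ler_ln ?posrE ?ltr0n ?expn_gt0 ?b_gt0 // ler_nat ltnW.
have := ler_wpM2r lnD0 kbig; nra.
Qed.

End Class.

(** * Summation over digit counts and lengths *)

Definition zuck_len (b N : nat) : {set 'I_(b ^ N)} :=
  [set n : 'I_(b ^ N) | (0 < \prod_(i < N) digit b n i)%N &&
     (\prod_(i < N) digit b n i %| n)%N]%SET.

(** Each digit count is at most [N], so there are at most [(N + 1) ^ b] classes; this adds [b] to
    the exponent. *)
Lemma card_zuck_len (R : realType) b N : (2 < b)%N -> (0 < N)%N ->
  #|zuck_len b N|%:R <= N.+1%:R ^+ (b + b * b) *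
    (expR b%:R * b%:R * expR (N%:R * (z_plus R b * ln b%:R))).
Proof.
move=> b2 N0; set K := expR _ * _ * _.
have K0 : 0 <= K by rewrite /K !mulr_ge0 ?expR_ge0.
pose t (n : 'I_(b ^ N)) : {ffun 'I_b -> 'I_N.+1} :=
  [ffun d : 'I_b => inord (digit_count b N n d)].
rewrite -sum1_card (partition_big t xpredT) //= natr_sum.
apply: (@le_trans _ _ (\sum_(c : {ffun 'I_b -> 'I_N.+1}) N%:R ^+ (b * b) * K)).
  apply: ler_sum => c _.
  apply: le_trans (card_zuck_class R (fun d => c d) b2 N0).
  rewrite ler_nat sum1_card; apply: subset_leq_card; apply/fintype.subsetP => n.
  rewrite unfold_in !inE => /andP[/andP[-> ->] /eqP <-] /=.
  by apply/forallP => d; rewrite ffunE inordK // ltnS digit_count_le.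
rewrite sumr_const card_ffun !card_ord -[leLHS]mulr_natl natrX mulrA ler_wpM2r //.
rewrite exprD ler_wpM2l ?exprn_ge0 // lerXn2r ?nnegrE // ler_nat.
exact: leqnSn.
Qed.

Lemma zuckerman_len b n : (2 < b)%N -> zuckerman b n ->
  exists2 m : 'I_(b ^ (trunc_log b n).+1),
    m \in zuck_len b (trunc_log b n).+1 & n = m.
Proof.
move=> b2 /andP[n0 dn]; exists (Ordinal (trunc_log_ltn n (ltnW b2))) => //.
by rewrite inE; apply/andP; split => //; exact: dvdn_gt0 n0 dn.
Qed.

Lemma card_Zuck (R : realType) b (x : R) : (2 < b)%N -> 0 <= x ->
  (#|` fset_set (Zuck b x)| <=
    \sum_(i < (trunc_log b (Num.trunc x)).+1) #|zuck_len b i.+1|)%N.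
Proof.
move=> b2 x0; set L := (trunc_log b _).+1.
have leT n : n%:R <= x -> (n <= Num.trunc x)%N by rewrite truncn_ge_nat.
(* [fset_set] is empty on infinite sets, so membership in it requires finiteness. *)
have finZ : finite_set (Zuck b x).
  apply: (@sub_finite_set _ _ `I_(Num.trunc x).+1); last exact: finite_II.
  by move=> n [_ /leT].
pose s := flatten [seq [seq val n | n <- enum (zuck_len b i.+1)] | i <- iota 0 L].
have -> : (\sum_(i < L) #|zuck_len b i.+1| = size s)%N.
  rewrite /s size_flatten /shape -map_comp sumnE big_map.
  rewrite -(big_mkord xpredT (fun i => #|zuck_len b i.+1|)) /index_iota subn0.
  by apply: eq_bigr => i _; rewrite /= size_map -cardE.
apply: uniq_leq_size; first exact: fset_uniq.
move=> n; rewrite in_fset_set // in_setE => -[zn nx].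
have [m mz nm] := zuckerman_len b2 zn.
apply/flattenP; exists [seq val n | n <- enum (zuck_len b (trunc_log b n).+1)].
  apply: (map_f (fun i => [seq val n | n <- enum (zuck_len b i.+1)])).
  by rewrite mem_iota /= add0n ltnS leq_trunc_log ?leT.
by apply/mapP; exists m => //; rewrite mem_enum.
Qed.

(** * Asymptotics and the error exponent *)

Lemma cvg_div_sqrt_ln (R : realType) (C : R) :
  C / Num.sqrt (ln x) @[x --> +oo] --> (0 : R).
Proof.
have pos : \forall x \near +oo, 0 < Num.sqrt (ln x) :> R.
  by near=> x; rewrite sqrtr_gt0 ln_gt0.
rewrite -(mulr0 C); apply: cvgM; first exact: cvg_cst.
apply/(gtr0_cvgV0 pos).
apply/cvgryPge => A; near=> x.
apply: (le_trans (ler_norm A)); rewrite -sqrtr_sqr ler_wsqrtr //.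
have /le_trans -> // : A ^+ 2 <= ln (expR (A ^+ 2)) by rewrite expRK.
have xA : expR (A ^+ 2) <= x by near: x; apply: nbhs_pinfty_ge; rewrite num_real.
by rewrite ler_ln ?posrE ?expR_gt0 // (lt_le_trans _ xA) ?expR_gt0.
Unshelve. all: by end_near.
Qed.

(** Absorbs a power of [ln x] into [expR] of a multiple of [sqrt (ln x)], through
    [v = (sqrt v) ^ 2 <= expR (2 sqrt v)]. *)
Lemma natr_le_expR_sqrt (R : realType) (n m : nat) (c y : R) :
  0 <= c -> 0 <= y -> n%:R <= c * y ->
  n%:R ^+ m <= expR (m%:R * (2 * (Num.sqrt c * Num.sqrt y))).
Proof.
move=> c0 y0 nle; rewrite expRM_natl lerXn2r ?nnegrE ?expR_ge0 //.
apply: le_trans nle _; rewrite -sqrtrM // -[leLHS]sqr_sqrtr ?mulr_ge0 //.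
rewrite expRM_natl lerXn2r ?nnegrE ?sqrtr_ge0 ?expR_ge0 //.
by apply: le_trans (expR_ge1Dx _); rewrite lerDr.
Qed.

Lemma trunc_log_le_ln (R : realType) b (x : R) : (1 < b)%N -> 1 <= x ->
  (trunc_log b (Num.trunc x))%:R * ln b%:R <= ln x.
Proof.
move=> b1 x1; have x0 : 0 <= x by rewrite (le_trans _ x1).
rewrite mulr_natl -lnXn ?ltr0n ?(ltnW b1) // -natrX.
have le : (b ^ trunc_log b (Num.trunc x))%:R <= x.
  rewrite -truncn_ge_nat //; apply: trunc_logP => //.
  by rewrite truncn_gt0.
by rewrite ler_ln ?posrE ?ltr0n ?expn_gt0 ?(ltnW b1) // (lt_le_trans _ x1).
Qed.

(** With [b ^ t <= x], lengths run up to [t + 1]. The extra digit costs [b ^ z_plus], and the number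
    of lengths costs one more power of [t + 2]. *)
Lemma card_Zuck_le (R : realType) b (x : R) : (2 < b)%N -> 1 <= x ->
  (#|` fset_set (Zuck b x)|%fset)%:R <=
    (trunc_log b (Num.trunc x)).+2%:R ^+ (b + b * b).+1 *
    (expR b%:R * b%:R * expR (z_plus R b * ln b%:R)) *
    expR (z_plus R b * ln x).
Proof.
move=> b2 x1; set A := (b + b * b).+1; set lambda := ln b%:R.
have x0 : 0 <= x by rewrite (le_trans _ x1).
set t := trunc_log b (Num.trunc x).
have z0 := z_plus_ge0 R b2.
have lam0 : 0 < lambda by rewrite ln_gt0 // ltr1n ltnW.
have tle : t%:R * lambda <= ln x by apply: trunc_log_le_ln => //; exact: ltnW.
set K := expR b%:R * b%:R; have K0 : 0 <= K by rewrite mulr_ge0 ?expR_ge0.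
have := card_Zuck b2 x0; rewrite -(ler_nat R) => /le_trans; apply.
rewrite natr_sum -/t.
pose B : R := t.+2%:R ^+ (b + b * b) *
  (K * expR (z_plus R b * lambda) * expR (z_plus R b * ln x)).
apply: (@le_trans _ _ (\sum_(i < t.+1) B)).
  apply: ler_sum => i _; apply: le_trans (card_zuck_len R b2 (ltn0Sn i)) _.
  apply: ler_pM; rewrite ?exprn_ge0 ?mulr_ge0 ?expR_ge0 //.
    by rewrite lerXn2r ?nnegrE // ler_nat !ltnS -ltnS.
  rewrite -/K -mulrA ler_wpM2l // -expRD ler_expR.
  have it : i%:R <= t%:R :> R by rewrite ler_nat -ltnS.
  apply: (@le_trans _ _ (t.+1%:R * (z_plus R b * lambda))).
    by rewrite ler_wpM2r ?mulr_ge0 ?(ltW lam0) // ler_nat ltnS -ltnS.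
  rewrite -natr1 mulrDl mul1r addrC lerD2l mulrCA.
  by rewrite ler_wpM2l.
rewrite sumr_const card_ord -[leLHS]mulr_natl.
have -> : t.+2%:R ^+ A * (K * expR (z_plus R b * lambda)) *
    expR (z_plus R b * ln x) = t.+2%:R * B by rewrite /B /A exprS; ring.
rewrite ler_wpM2r ?ler_nat //.
by rewrite /B !mulr_ge0 ?expR_ge0 ?exprn_ge0.
Qed.

Theorem theorem4p1 (R : realType) (b : nat) (hb : (3 <= b)%N) :
  exists o : R -> R,
    o x @[x --> +oo] --> (0 : R) /\
    (\forall x \near +oo,
       (#|` fset_set (Zuck b x)|%fset)%:R < x `^ (z_plus R b + o x)).
Proof.
pose A := (b + b * b).+1; pose lambda : R := ln b%:R.
pose K : R := expR b%:R * b%:R * expR (z_plus R b * lambda).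
(* [c] gives [t + 2 <= c ln x] once [ln x >= 1]. [C] adds the cost of the polynomial factor to that
   of the constant [K]; the exponent [C / sqrt (ln x)] yields the factor [expR (C sqrt (ln x))]. *)
pose c : R := lambda^-1 + 2.
pose C : R := K + A%:R * (2 * Num.sqrt c).
exists (fun x => C / Num.sqrt (ln x)); split; first exact: cvg_div_sqrt_ln.
near=> x.
have xe : expR 1 <= x by near: x; apply: nbhs_pinfty_ge; rewrite num_real.
have x0 : 0 < x by rewrite (lt_le_trans (expR_gt0 1) xe).
have y1 : 1 <= ln x by rewrite -[leLHS]expRK ler_ln ?posrE ?expR_gt0.
have x1 : 1 <= x by apply: le_trans xe; apply: le_trans (expR_ge1Dx 1); rewrite lerDr.
have y0 : 0 <= ln x by rewrite (le_trans _ y1).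
have lam0 : 0 < lambda by rewrite ln_gt0 // ltr1n ltnW.
have c0 : 0 <= c by rewrite addr_ge0 // invr_ge0 ltW.
have K0 : 0 <= K by rewrite !mulr_ge0 ?expR_ge0.
apply: le_lt_trans (card_Zuck_le hb x1) _.
rewrite -/lambda -/K -/A.
set t := trunc_log b (Num.trunc x).
have tle : t.+2%:R <= c * ln x.
  have := trunc_log_le_ln (ltnW hb) x1; rewrite -/t -/lambda -ler_pdivlMr // => h.
  rewrite -addn2 natrD mulrDl lerD //; first by rewrite mulrC.
  by rewrite ler_peMr.
have s1 : 1 <= Num.sqrt (ln x) by rewrite -sqrtr1 ler_wsqrtr.
have sy : Num.sqrt (ln x) != 0 by rewrite gt_eqF // (lt_le_trans _ s1).
have -> : x `^ (z_plus R b + C / Num.sqrt (ln x)) =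
    expR (A%:R * (2 * (Num.sqrt c * Num.sqrt (ln x)))) *
    expR (K * Num.sqrt (ln x)) * expR (z_plus R b * ln x).
  rewrite /powR gt_eqF // -!expRD; congr expR.
  have := sqr_sqrtr y0; set r := Num.sqrt (ln x) in sy * => rE.
  by rewrite -rE /C; field.
rewrite ltr_pM2r ?expR_gt0 //.
apply: (@le_lt_trans _ _ (expR (A%:R * (2 * (Num.sqrt c * Num.sqrt (ln x)))) * K)).
  by rewrite ler_wpM2r // natr_le_expR_sqrt.
rewrite ltr_pM2l ?expR_gt0 //.
(* Strictness comes from [K < 1 + K <= expR K]. *)
apply: (@lt_le_trans _ _ (expR K)).
  by apply: lt_le_trans (expR_ge1Dx K); rewrite ltrDr.
by rewrite ler_expR ler_peMr.
Unshelve. all: by end_near.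
Qed.
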